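(* Let $n=2$, $F(\theta)=\theta$ on $[0,1]$, and let the cost structure be separable. Then for the score floor mechanism the threshold $\theta_0^*$ in the (buyer-)optimal mechanism is weakly greater than in the efficient mechanism, while for the score ceiling mechanism the threshold $\theta_0^*$ in the (buyer-)optimal mechanism is weakly lower than in the efficient mechanism.
   Context: Setting. Two firms have types $\theta_i$, independent and uniform on $[0,1]$. Separable cost structure: the buyer's value of quality is $V(q)=q$, the production cost is $C^P(q,\theta)=\alpha\theta$ with $\alpha>0$, the investment cost is $C^I(q,\theta)=g(q)$ with $g(0)=g'(0)=0$, $g'(q)>0$ and $g''(q)>0$ for $q>0$, and $g'(q)>1$ for all large $q$. For outcome functions $(z_i(\bm\theta),q_i(\theta_i))_{i=1,2}$, the buyer's expected utility (which accounts for virtual costs) is $U=\mathbb E\sum_{i=1}^2\big((q_i(\theta_i)-2\alpha\theta_i)z_i(\bm\theta)-g(q_i(\theta_i))\big)$, and social welfare (which accounts for actual costs) is $W=\mathbb E\sum_{i=1}^2\big((q_i(\theta_i)-\alpha\theta_i)z_i(\bm\theta)-g(q_i(\theta_i))\big)$. Let $q^*_{sym}(\theta)=(g')^{-1}(1-\theta)$. The score floor mechanism with threshold $\theta_0\in[0,1]$ induces the right-censored outcomes: with $\tilde\theta_1=\min(\theta_0,\theta_1)$, $z_1=\mathbb I(\tilde\theta_1<\theta_2)$, $z_2=1-z_1$, $q_1(\theta_1)=q^*_{sym}(\tilde\theta_1)$, $q_2(\theta_2)=q^*_{sym}(\theta_2)$ if $\theta_2<\theta_0$ and $q_2(\theta_2)=q^*_{sym}(1)=0$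 if $\theta_2>\theta_0$. The score ceiling mechanism with threshold $\theta_0\in[0,1]$ induces the left-censored outcomes: with $\tilde\theta_2=\max(\theta_0,\theta_2)$, $z_2=\mathbb I(\tilde\theta_2<\theta_1)$, $z_1=1-z_2$, $q_2(\theta_2)=q^*_{sym}(\tilde\theta_2)$, $q_1(\theta_1)=q^*_{sym}(\theta_1)$ if $\theta_1>\theta_0$ and $q_1(\theta_1)=q^*_{sym}(0)$ if $\theta_1<\theta_0$. Within each of the two families, the threshold in the optimal mechanism is a maximizer of $U$ over $\theta_0\in[0,1]$, and the threshold in the efficient mechanism is a maximizer of $W$ over $\theta_0\in[0,1]$. *)

(* Defs.v *)
From HB Require Import structures.
From mathcomp Require Import all_boot all_order all_algebra.
From mathcomp Require Import all_classical all_reals all_analysis.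
Set Implicit Arguments.
Unset Strict Implicit.
Unset Printing Implicit Defensive.
Import Order.TTheory GRing.Theory Num.Theory.
Import numFieldNormedType.Exports.
Local Open Scope classical_set_scope.
Local Open Scope ring_scope.

Section types.
Context {R : realType}.

Definition uniform01 : probability (measurableTypeR R) R :=
  uniform_prob (@ltr01 R).

(* Joint law of the type profile (theta_1, theta_2): independent uniforms. *)
Definition type_law : set (measurableTypeR R * measurableTypeR R) -> \bar R :=
  (uniform01 \x uniform01)%E.

HB.instance Definition _ := Measure.on type_law.

Lemma type_law_setT : type_law setT = 1%E.
Proof.
rewrite /type_law -setXTT product_measure1E//.
by rewrite [X in (X * _)%E]probability_setT mul1e [LHS]probability_setT.
Qed.

HB.instance Definition _ :=
  Measure_isProbability.Build _ _ _ type_law type_law_setT.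

End types.

Section mechanisms.
Context {R : realType}.
Implicit Types (g dg d2g : R -> R) (alpha t : R).

(* The investment cost g is only meant on [0, +oo[: its values on negative
   arguments are irrelevant, so the derivative at 0 is one-sided.  dg and d2g
   are the first derivative on [0, +oo[ and the second one on ]0, +oo[. *)
Record investment_cost g dg d2g : Prop := InvestmentCost {
  inv_cost0 : g 0 = 0 ;
  inv_cost_right_derive0 : (g h - g 0) / h @[h --> (0 : R)^'+] --> dg 0 ;
  inv_cost_derive : forall q : R, 0 < q -> is_derive q 1 g (dg q) ;
  inv_cost_derive2 : forall q : R, 0 < q -> is_derive q 1 dg (d2g q) ;
  inv_cost_marginal0 : dg 0 = 0 ;
  inv_cost_marginal_gt0 : forall q : R, 0 < q -> 0 < dg q ;
  inv_cost_convex : forall q : R, 0 < q -> 0 < d2g q ;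
  inv_cost_marginal_large : \forall q \near (+oo : set_system R), 1 < dg q }.

(* (g')^-1 (1 - theta), where g' is a function on [0, +oo[. The default value 0
   is only used when 1 - theta is not in the range of g', which never happens
   for theta in [0, 1]. *)
Definition qsym dg (theta : R) : R :=
  'pinv_(fun=> 0) `[0, +oo[%classic dg (1 - theta).

Record outcome := Outcome {
  z1 : R * R -> R ;
  z2 : R * R -> R ;
  q1 : R -> R ;
  q2 : R -> R }.

(* Firm i incurs the (virtual) production cost 2 * alpha * theta_i. *)
Definition buyer_utility g alpha (o : outcome) : \bar R :=
  'E_(type_law)[fun th : R * R =>
      ((q1 o th.1 - 2 * alpha * th.1) * z1 o th - g (q1 o th.1)) +
      ((q2 o th.2 - 2 * alpha * th.2) * z2 o th - g (q2 o th.2))].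

Definition social_welfare g alpha (o : outcome) : \bar R :=
  'E_(type_law)[fun th : R * R =>
      ((q1 o th.1 - alpha * th.1) * z1 o th - g (q1 o th.1)) +
      ((q2 o th.2 - alpha * th.2) * z2 o th - g (q2 o th.2))].

(* The boundary cases theta_2 = t (floor) and theta_1 = t (ceiling), a null
   event, are put in the censored branch. *)
Definition score_floor dg t : outcome := {|
  z1 := fun th => (Num.min t th.1 < th.2)%R%:R ;
  z2 := fun th => 1 - (Num.min t th.1 < th.2)%R%:R ;
  q1 := fun th1 => qsym dg (Num.min t th1) ;
  q2 := fun th2 => if th2 < t then qsym dg th2 else qsym dg 1 |}.

Definition score_ceiling dg t : outcome := {|
  z1 := fun th => 1 - (Num.max t th.2 < th.1)%R%:R ;
  z2 := fun th => (Num.max t th.2 < th.1)%R%:R ;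
  q1 := fun th1 => if t < th1 then qsym dg th1 else qsym dg 0 ;
  q2 := fun th2 => qsym dg (Num.max t th2) |}.

Definition maximizer01 (J : R -> \bar R) t : Prop :=
  0 <= t <= 1 /\ forall s : R, 0 <= s <= 1 -> (J s <= J t)%E.

Definition optimal_threshold g alpha (mech : R -> outcome) : R -> Prop :=
  maximizer01 (fun t => buyer_utility g alpha (mech t)).

Definition efficient_threshold g alpha (mech : R -> outcome) : R -> Prop :=
  maximizer01 (fun t => social_welfare g alpha (mech t)).

End mechanisms.

(* Main.v *)
(* The buyer's utility is U = W - alpha D, where W is social welfare and
   D = E[theta_1 z_1 + theta_2 z_2] is the expected type of the producing firm.
   Comparing a maximizer of U with a maximizer of W (revealed preference) shows
   that D is weakly smaller at the former.  Raising the threshold makes the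
   allocation of the score floor mechanism more efficient and that of the score
   ceiling mechanism less efficient, so D is strictly decreasing in the
   threshold for the former and strictly increasing for the latter. *)

Require Import Defs.
From mathcomp Require Import all_boot all_order all_algebra.
From mathcomp Require Import all_classical all_reals all_analysis.
From mathcomp Require Import measurable_realfun.
From mathcomp Require Import lra ring.
Import Order.TTheory GRing.Theory Num.Theory.
Import numFieldNormedType.Exports.
Local Open Scope classical_set_scope.
Local Open Scope ring_scope.

(** * Pseudo-inverse outside and inside the image *)

Lemma pinv_out {T U : Type} (dflt : U -> T) (A : set T) (f : T -> U) y :
  ~ (f @` A) y -> 'pinv_dflt A f y = dflt y.
Proof.
by move=> fAy; rewrite /pinv_ splitV oinv_surj; case: pselect.
Qed.

Lemma pinv_in {T U : Type} (dflt : U -> T) {A : set T} {f : T -> U} {y} :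
  (f @` A) y -> A ('pinv_dflt A f y).
Proof. by move=> fAy; rewrite /pinv_ splitV; case: oinvP. Qed.

(** * Monotonicity of the cost and marginal cost; regularity of [qsym] *)

Section investment_cost_theory.
Context {R : realType} {g dg d2g : R -> R}.
Hypothesis g_cost : investment_cost g dg d2g.

Lemma marginal_within_continuous {a b : R} : 0 < a ->
  {within `[a, b], continuous dg}.
Proof.
move=> a0; apply: derivable_within_continuous => x.
rewrite in_itv/= => /andP[ax _].
by have [] := inv_cost_derive2 g_cost (lt_le_trans a0 ax).
Qed.

(** The mean value theorem is applied away from 0, where [dg] is differentiable; for [x = 0] the
    inequality is the sign of [dg]. *)
Lemma marginal_lt {x y : R} : 0 <= x -> x < y -> dg x < dg y.
Proof.
rewrite le_eqVlt => /orP[/eqP <- y0|x0 xy].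
  by rewrite (inv_cost_marginal0 g_cost) (inv_cost_marginal_gt0 g_cost).
have dgd z : z \in `]x, y[ -> is_derive z 1 dg (d2g z).
  rewrite in_itv/= => /andP[/(lt_trans x0) z0 _].
  exact: (inv_cost_derive2 g_cost).
have [z] := MVT xy dgd (marginal_within_continuous x0).
rewrite in_itv/= => /andP[/(lt_trans x0) z0 _] eq_z.
by rewrite -subr_gt0 eq_z mulr_gt0 ?subr_gt0 ?(inv_cost_convex g_cost).
Qed.

(** On positive arguments this is the mean value theorem. At 0, the right difference quotient times
    [h] tends to 0, so [g] is right-continuous there, and [g h <= g y] passes to the limit. *)
Lemma investment_cost_le : {in `[0, +oo[ &, {homo g : x y / x <= y}}.
Proof.
have lt_pos (x y : R) : 0 < x -> x < y -> g x < g y.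
  move=> x0 xy.
  have gc : {within `[x, y], continuous g}.
    apply: derivable_within_continuous => z.
    rewrite in_itv/= => /andP[xz _].
    by have [] := inv_cost_derive g_cost (lt_le_trans x0 xz).
  have gd z : z \in `]x, y[ -> is_derive z 1 g (dg z).
    rewrite in_itv/= => /andP[/(lt_trans x0) z0 _].
    exact: (inv_cost_derive g_cost).
  have [z] := MVT xy gd gc.
  rewrite in_itv/= => /andP[/(lt_trans x0) z0 _] eq_z.
  by rewrite -subr_gt0 eq_z mulr_gt0 ?subr_gt0 ?(inv_cost_marginal_gt0 g_cost).
have g_right0 : g h @[h --> (0 : R)^'+] --> (0 : R).
  have id0 : (h : R) @[h --> (0 : R)^'+] --> (0 : R).
    exact: cvg_within.
  have gh : (g h - g 0) / h * h @[h --> (0 : R)^'+] --> dg 0 * 0.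
    exact: cvgM (inv_cost_right_derive0 g_cost) id0.
  rewrite -[X in _ --> X](mulr0 (dg 0)); apply: cvg_trans gh.
  apply: near_eq_cvg; near=> h.
  rewrite (inv_cost0 g_cost) subr0 /= divfK// gt_eqF//.
move=> x y; rewrite !in_itv/= !andbT => x0 y0.
rewrite le_eqVlt => /orP[/eqP -> //|xy].
move: x0; rewrite le_eqVlt => /orP[/eqP x0|x0]; last exact/ltW/lt_pos.
rewrite -x0 (inv_cost0 g_cost); move: xy; rewrite -x0 => {}y0.
apply: cvgr_to_le g_right0 _; near=> h; apply/ltW/lt_pos.
  by near: h; exact: nbhs_right_gt.
by near: h; exact: nbhs_right_lt.
Unshelve. all: by end_near. Qed.

(** Measurability concerns the whole line, where the default value 0 does occur (for instance when
    [theta > 1]), so both cases are kept. *)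
Lemma qsymP (theta : R) :
  (0 <= qsym dg theta /\ dg (qsym dg theta) = 1 - theta) \/
  (qsym dg theta = 0 /\ forall q, 0 <= q -> dg q <> 1 - theta).
Proof.
have [imdg|imdg] := pselect ((dg @` `[0, +oo[) (1 - theta)).
  left; split; last by apply: pinvK; rewrite inE.
  have := pinv_in (fun=> 0) imdg.
  by rewrite /= in_itv/= andbT.
right; split; first exact: pinv_out.
by move=> q q0 dgq; apply: imdg; exists q => //; rewrite /= in_itv/= q0.
Qed.

Lemma qsym_ge0 (theta : R) : 0 <= qsym dg theta.
Proof. by have [[]|[->]] := qsymP theta. Qed.

(** Since [0 <= a], the default value 0 never exceeds [a]: the superlevel sets of [qsym] are
    described by [dg] alone. *)
Lemma lt_qsymP {theta a : R} : 0 <= a ->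
  a < qsym dg theta <-> exists2 q, a < q & dg q = 1 - theta.
Proof.
move=> a0; split=> [aq|[q aq dgq]].
  have [[_ <-]|[q0 _]] := qsymP theta; first by exists (qsym dg theta).
  by move: aq; rewrite q0 ltNge a0.
have [[q0 eq_q]|[_ /(_ q)]] := qsymP theta; last first.
  by move=> /(_ (ltW (le_lt_trans a0 aq))).
rewrite (lt_le_trans aq)// leNgt; apply/negP => /(marginal_lt q0).
by rewrite eq_q dgq ltxx.
Qed.

(** Because of the default value, [qsym] need not be monotone on the whole line, but its superlevel
    sets are intervals: for [0 <= a], solutions [q <= p] above [a] at the two ends yield one in
    between by the intermediate value theorem. *)
Lemma measurable_qsym : measurable_fun setT (qsym dg).
Proof.
apply: (measurability (@RGenOInfty.G R)) => [|_ [_ [a ->] <-]].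
  exact: RGenOInfty.measurableE.
rewrite setTI; apply: is_interval_measurable.
have [a0|a0] := leP 0 a; last first.
  move=> x y _ _ z _ /=; rewrite in_itv/= andbT.
  exact: lt_le_trans a0 (qsym_ge0 z).
move=> x y /=; rewrite !in_itv/= !andbT.
move=> /(lt_qsymP a0)[p ap dgp] /(lt_qsymP a0)[q aq dgq].
move=> z /andP[xz zy]; rewrite in_itv/= andbT; apply/(lt_qsymP a0).
have qp : q <= p.
  rewrite leNgt; apply/negP => /(marginal_lt (ltW (le_lt_trans a0 ap))).
  by rewrite dgp dgq => H; move: xz zy; lra.
have dgc := marginal_within_continuous (b := p) (le_lt_trans a0 aq).
have [|r] := IVT (v := 1 - z) qp dgc.
  have dgqp : dg q <= dg p by rewrite dgp dgq; lra.
  rewrite minEle maxEle dgqp dgp dgq; apply/andP; split; lra.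
rewrite in_itv/= => /andP[qr _] dgr; exists r => //; exact: lt_le_trans qr.
Qed.

(** Marginal cost exceeds 1 beyond some [Q], whereas a solution has marginal cost
    [1 - theta <= 1]. *)
Lemma qsym_bounded : exists2 Q : R, 0 <= Q &
  forall theta, 0 <= theta -> qsym dg theta <= Q.
Proof.
have [Q [Qreal dgQ]] := inv_cost_marginal_large g_cost.
exists (Num.max 0 Q); first by rewrite le_max lexx.
move=> theta theta0; rewrite leNgt; apply/negP => Qq.
have Q0 : 0 <= Num.max 0 Q by rewrite le_max lexx.
have [q qQ dgq] := (lt_qsymP Q0).1 Qq.
have : 1 < dg q by apply: dgQ; move: qQ; rewrite gt_max => /andP[].
by rewrite dgq; lra.
Qed.

Lemma measurable_investment_cost_qsym : measurable_fun setT (g \o qsym dg).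
Proof.
(* [g] is monotone only on nonnegative arguments; precomposing with [Num.max 0] makes it monotone
   everywhere and changes nothing on the values of [qsym]. *)
rewrite [X in measurable_fun _ X](_ : _ = (g \o Num.max 0) \o qsym dg).
  apply: measurableT_comp measurable_qsym.
  apply: nondecreasing_measurable => // x y xy /=.
  apply: investment_cost_le.
  - by rewrite in_itv/= andbT le_max lexx.
  - by rewrite in_itv/= andbT le_max lexx.
  - by rewrite ge_max !le_max lexx xy orbT.
by apply/funext => x /=; rewrite max_r// qsym_ge0.
Qed.

Lemma investment_cost_qsym_bounded : exists M : R,
  forall theta, 0 <= theta -> `|g (qsym dg theta)| <= M.
Proof.
have [Q Q0 qQ] := qsym_bounded.
have pos (x : R) : 0 <= x -> x \in `[0, +oo[ by rewrite in_itv/= andbT.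
exists (g Q) => theta /qQ q_le; rewrite ger0_norm.
  exact: (investment_cost_le _ _ (pos _ (qsym_ge0 _)) (pos _ Q0) q_le).
rewrite -(inv_cost0 g_cost).
exact: (investment_cost_le _ _ (pos _ (lexx _)) (pos _ (qsym_ge0 _))
  (qsym_ge0 _)).
Qed.

End investment_cost_theory.

(** * Integrability and rectangles under the law of the type profile *)

Section type_law_theory.
Context {R : realType}.
Local Notation profile := (measurableTypeR R * measurableTypeR R)%type.
Implicit Types (f h : profile -> R).

Definition unit_square : set profile := `[0, 1]%classic `*` `[0, 1]%classic.

Lemma uniform01E (A : set R) : measurable A -> A `<=` `[0, 1] ->
  uniform01 (A : set (measurableTypeR R)) = lebesgue_measure A.
Proof.
move=> mA A01; transitivity (\int[lebesgue_measure]_(x in A) (cst 1 x))%E.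
  apply: eq_integral => x; rewrite inE => /A01.
  by rewrite /= in_itv/= /uniform_pdf => ->; rewrite subr0 invr1.
by rewrite integral_cst// mul1e.
Qed.

Lemma type_law_unit_square : type_law unit_square = 1%E.
Proof.
rewrite /type_law product_measure1E//.
by rewrite -[RHS]mule1; congr (_ * _)%E;
  rewrite [LHS]uniform01E ?lebesgue_measure_itv/= ?lte_fin ?ltr01 ?sube0//.
Qed.

(* Types outside [0, 1] have probability zero but still belong to the carrier,
   so that integrands are only bounded on the unit square. *)
Definition square_bounded f : Prop :=
  measurable_fun setT f /\ exists M, forall th, unit_square th -> `|f th| <= M.

Lemma square_boundedD f h : square_bounded f -> square_bounded h ->
  square_bounded (f \+ h).
Proof.
move=> [mf [M fM]] [mh [N hN]]; split; first exact: measurable_funD.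
exists (M + N) => th thP; rewrite (le_trans (ler_normD _ _))//.
by rewrite lerD ?fM ?hN.
Qed.

Lemma square_boundedM f h : square_bounded f -> square_bounded h ->
  square_bounded (f \* h).
Proof.
move=> [mf [M fM]] [mh [N hN]]; split; first exact: measurable_funM.
exists (M * N) => th thP; rewrite normrM.
by rewrite ler_pM ?fM ?hN.
Qed.

Lemma square_bounded_cst (c : R) : square_bounded (fun=> c).
Proof. by split; [exact: measurable_cst|exists `|c|]. Qed.

Lemma square_boundedB f h : square_bounded f -> square_bounded h ->
  square_bounded (f \- h).
Proof.
move=> [mf [M fM]] [mh [N hN]]; split; first exact: measurable_funB.
exists (M + N) => th thP; rewrite (le_trans (ler_normB _ _))//.
by rewrite lerD ?fM ?hN.
Qed.

Lemma square_bounded_fst : square_bounded fst.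
Proof.
split; first exact: measurable_fst.
exists 1 => -[x y] [/=]; rewrite !in_itv/= => /andP[x0 x1] _.
by rewrite ger0_norm.
Qed.

Lemma square_bounded_snd : square_bounded snd.
Proof.
split; first exact: measurable_snd.
exists 1 => -[x y] [/=]; rewrite !in_itv/= => _ /andP[x0 x1].
by rewrite ger0_norm.
Qed.

Lemma square_bounded_lt f h : measurable_fun setT f -> measurable_fun setT h ->
  square_bounded (fun th => (f th < h th)%R%:R).
Proof.
move=> mf mh; split.
  have mfh := measurable_fun_ltr mf mh.
  rewrite [X in measurable_fun _ X](_ : _ =
      fun th => if f th < h th then 1 else 0).
    exact: measurable_fun_ifT.
  by apply/funext => th; case: ifP.
by exists 1 => th _; case: (_ < _); rewrite ?normr1 ?normr0.
Qed.

(** The complement of the unit square is negligible, and on the square the function is bounded with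
    finite measure. *)
Lemma square_bounded_Lfun f : square_bounded f -> f \in Lfun type_law 1.
Proof.
move=> [mf [M fM]]; apply/Lfun1_integrable.
have mS : measurable unit_square by exact: measurableX.
apply/(@negligible_integrable _ _ _ _ _ (~` unit_square)) => //.
- exact: measurableC.
- exact/measurable_EFinP.
- have := probability_setC type_law mS.
  by rewrite [X in (1 - X)%E]type_law_unit_square subee.
rewrite setTD setCK; apply: measurable_bounded_integrable => //.
- by rewrite [X in (X < _)%E]type_law_unit_square ltry.
- exact: measurable_funTS.
exists M; split; first exact: num_real.
by move=> N MN th thP; exact: le_trans (fM _ thP) (ltW MN).
Qed.

Lemma square_bounded_indic (A : set profile) : measurable A ->
  square_bounded (\1_A : profile -> R).
Proof.
move=> mA; split; first exact: measurable_indic.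
by exists 1 => th _; rewrite indicE; case: (_ \in _); rewrite ?normr1 ?normr0.
Qed.

Lemma square_bounded_le f h : square_bounded f -> square_bounded h ->
  (forall th, f th <= h th) -> ('E_type_law[f] <= 'E_type_law[h])%E.
Proof.
move=> bf bh fh; rewrite unlock; apply: le_integral => //.
- exact/Lfun1_integrable/square_bounded_Lfun.
- exact/Lfun1_integrable/square_bounded_Lfun.
- by move=> th _; rewrite lee_fin.
Qed.

Lemma type_law_rect (a b c d : R) : 0 <= a -> a < b -> b <= 1 ->
  0 <= c -> c < d -> d <= 1 ->
  type_law (`]a, b]%classic `*` `]c, d]%classic) = ((b - a) * (d - c))%:E.
Proof.
have itv01 (x y : R) : 0 <= x -> y <= 1 -> `]x, y] `<=` `[0, 1].
  move=> x0 y1 z /=; rewrite !in_itv/= => /andP[xz zy].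
  by rewrite (le_trans x0 (ltW xz)) (le_trans zy).
move=> a0 ab b1 c0 cd d1; rewrite /type_law product_measure1E// EFinM.
by congr (_ * _)%E; rewrite [LHS]uniform01E//;
  rewrite ?lebesgue_measure_itv/= ?lte_fin ?ab ?cd//; exact: itv01.
Qed.

End type_law_theory.

(** * Expected type of the producing firm: welfare accounting, revealed preference, dependence on
    the threshold *)

Section mechanism_theory.
Context {R : realType}.
Local Notation profile := (measurableTypeR R * measurableTypeR R)%type.
Implicit Types (g : R -> R) (alpha s t : R) (o : @outcome R) (th : profile).

(** The factor [alpha] is left out; the expectation is the quantity D of the overview. *)
Definition production_cost o : profile -> R :=
  fun th => th.1 * z1 o th + th.2 * z2 o th.

(** The ingredients of the welfare integrand. The compositions with [g] are listed separately
    because nothing is known of [g] on negative arguments. *)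
Record bounded_outcome g o : Prop := BoundedOutcome {
  bounded_z1 : square_bounded (z1 o) ;
  bounded_z2 : square_bounded (z2 o) ;
  bounded_q1 : square_bounded (q1 o \o fst) ;
  bounded_q2 : square_bounded (q2 o \o snd) ;
  bounded_g1 : square_bounded (g \o q1 o \o fst) ;
  bounded_g2 : square_bounded (g \o q2 o \o snd) }.

Lemma production_cost_bounded g o : bounded_outcome g o ->
  square_bounded (production_cost o).
Proof.
by case=> *; apply: square_boundedD; apply: square_boundedM => //;
  [exact: square_bounded_fst|exact: square_bounded_snd].
Qed.

Lemma production_cost_Lfun g o : bounded_outcome g o ->
  production_cost o \in Lfun type_law 1.
Proof. by move=> /production_cost_bounded/square_bounded_Lfun. Qed.

Lemma production_cost_fin_num g o : bounded_outcome g o ->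
  ('E_(type_law)[production_cost o])%E \is a fin_num.
Proof. by move=> /production_cost_Lfun; exact: expectation_fin_num. Qed.

Definition welfare g alpha o : profile -> R := fun th =>
  ((q1 o th.1 - alpha * th.1) * z1 o th - g (q1 o th.1)) +
  ((q2 o th.2 - alpha * th.2) * z2 o th - g (q2 o th.2)).

Lemma welfare_Lfun g alpha o : bounded_outcome g o ->
  welfare g alpha o \in Lfun type_law 1.
Proof.
case=> *; apply: square_bounded_Lfun.
apply: square_boundedD; apply: square_boundedB => //;
  apply: square_boundedM => //; apply: square_boundedB => //;
  apply: square_boundedM; try exact: square_bounded_cst.
  exact: square_bounded_fst.
exact: square_bounded_snd.
Qed.

Lemma social_welfare_fin_num g alpha o : bounded_outcome g o ->
  social_welfare g alpha o \is a fin_num.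
Proof. by move=> /(welfare_Lfun g alpha); exact: expectation_fin_num. Qed.

(** Virtual cost exceeds actual cost by [alpha] times the producer's type; integrability of both
    terms splits the expectation. *)
Lemma buyer_utilityE g alpha o : bounded_outcome g o ->
  buyer_utility g alpha o =
  (social_welfare g alpha o - alpha%:E * 'E_(type_law)[production_cost o])%E.
Proof.
move=> og; have LD := production_cost_Lfun _ _ og.
have LaD : alpha \o* production_cost o \in Lfun type_law 1.
  apply/square_bounded_Lfun/square_boundedM; last exact: square_bounded_cst.
  exact: production_cost_bounded og.
rewrite -(expectationZl alpha LD).
rewrite -(expectationB (welfare_Lfun g alpha _ og) LaD).
congr expectation; apply/funext => th /=.
rewrite /welfare /production_cost; ring.
Qed.

Lemma revealed_preference g alpha (mech : R -> outcome) topt teff :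
  0 < alpha -> (forall t, 0 <= t <= 1 -> bounded_outcome g (mech t)) ->
  optimal_threshold g alpha mech topt ->
  efficient_threshold g alpha mech teff ->
  ('E_(type_law)[production_cost (mech topt)] <=
   'E_(type_law)[production_cost (mech teff)])%E.
Proof.
move=> alpha0 bmech [topt01 opt] [teff01 eff].
move: (opt _ teff01) (eff _ topt01).
have [bopt beff] := (bmech _ topt01, bmech _ teff01).
rewrite !buyer_utilityE//.
move: (social_welfare_fin_num g alpha _ bopt).
move: (social_welfare_fin_num g alpha _ beff).
move: (production_cost_fin_num _ _ bopt) (production_cost_fin_num _ _ beff).
(* All four expectations are finite, so the two optimality inequalities can be added as real
   inequalities. *)
move=> /fineK <- /fineK <- /fineK <- /fineK <-.
rewrite -!EFinM -!EFinB !lee_fin => optW effW.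
rewrite -(ler_pM2l alpha0); lra.
Qed.

(* On a rectangle whose points satisfy x - y >= (t - s) / 3, the allocation at
   one threshold selects the firm of type x and the other the firm of type y;
   this set of positive probability makes the inequality strict. *)
Lemma production_cost_lt g o o' s t : 0 <= s -> s < t -> t <= 1 ->
  bounded_outcome g o -> bounded_outcome g o' ->
  (forall x y, production_cost o (x, y) <= production_cost o' (x, y)) ->
  (forall x y, s < y -> y <= s + (t - s) / 3 ->
    s + (t - s) / 3 * 2 < x -> x <= t ->
    production_cost o (x, y) + (t - s) / 3 <= production_cost o' (x, y)) ->
  ('E_(type_law)[production_cost o] < 'E_(type_law)[production_cost o'])%E.
Proof.
move=> s0 st t1 og og' oo' gap.
set d := (t - s) / 3 in gap *.
have d0 : 0 < d by rewrite /d; lra.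
(* Both sides have length [d], so the expected gap is at least [d] times the mass [d * d]. The
   half-open sides keep [s < y] and [x <= t], which settle ties at the thresholds. *)
pose A : set profile := `]s + d * 2, t]%classic `*` `]s, s + d]%classic.
have mA : measurable A by exact: measurableX.
have EA : type_law A = (d * d)%:E.
  by rewrite type_law_rect; [congr EFin; rewrite /d; field|rewrite /d; lra..].
have bA : square_bounded (\1_A : profile -> R) by exact: square_bounded_indic.
have bdA : square_bounded (d \o* \1_A).
  exact: square_boundedM bA (square_bounded_cst d).
have bo := production_cost_bounded _ _ og.
have bo' := production_cost_bounded _ _ og'.
have : ('E_(type_law)[d \o* \1_A] <=
        'E_(type_law)[production_cost o' \- production_cost o])%E.
  apply: square_bounded_le => //; first exact: square_boundedB.
  move=> [x y]; rewrite /= indicE; have := oo' x y.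
  case: (boolP (_ \in _)) => [|_]; last by rewrite mul0r; lra.
  rewrite inE => -[/=]; rewrite !in_itv/= => /andP[? ?] /andP[? ?] _.
  have := gap x y; lra.
rewrite expectationZl ?square_bounded_Lfun// expectation_indic//.
rewrite expectationB ?square_bounded_Lfun// [X in (d%:E * X)%E]EA => dE.
rewrite -sube_gt0; apply: lt_le_trans dE.
by rewrite -EFinM lte_fin; exact: mulr_gt0 d0 (mulr_gt0 d0 d0).
Qed.

Section bounded_mechanisms.
Context {g dg d2g : R -> R} (g_cost : investment_cost g dg d2g).

(** Here [f] is the possibly censored type that determines quality. *)
Lemma qsym_square_bounded (f : profile -> R) : measurable_fun setT f ->
  (forall th, unit_square th -> 0 <= f th) ->
  square_bounded (qsym dg \o f) /\ square_bounded (g \o qsym dg \o f).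
Proof.
move=> mf f0; split; split.
- exact: measurableT_comp (measurable_qsym g_cost) mf.
- have [Q _ qQ] := qsym_bounded g_cost; exists Q => th /f0/qQ.
  by rewrite ger0_norm// qsym_ge0.
- exact: measurableT_comp (measurable_investment_cost_qsym g_cost) mf.
- have [M gM] := investment_cost_qsym_bounded g_cost.
  by exists M => th /f0/gM.
Qed.

Lemma score_floor_bounded t : 0 <= t <= 1 ->
  bounded_outcome g (score_floor dg t).
Proof.
move=> /andP[t0 t1].
have m1 : measurable_fun setT (fun th : profile => Num.min t th.1).
  exact: measurable_minr.
(* Censored quality is [qsym] at a modified type: firm 2 is treated as type 1 from the threshold
   on. *)
have m2 : measurable_fun setT
    (fun th : profile => if th.2 < t then th.2 else 1).
  by apply: measurable_fun_ifT => //; exact: measurable_fun_ltr.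
have [|b1 bg1] := qsym_square_bounded _ m1.
  by move=> [x y] [/=]; rewrite !in_itv/= le_min t0 => /andP[->].
have [|b2 bg2] := qsym_square_bounded _ m2.
  by move=> [x y] [/=]; rewrite !in_itv/= => _ /andP[y0 _]; case: ifP.
have q2E : q2 (score_floor dg t) \o snd =
    qsym dg \o (fun th : profile => if th.2 < t then th.2 else 1).
  by apply/funext => th /=; case: ifP.
have bz : square_bounded (z1 (score_floor dg t)).
  exact: square_bounded_lt.
split => //.
- exact: square_boundedB (square_bounded_cst 1) bz.
- by rewrite q2E.
- by rewrite -compA q2E.
Qed.

Lemma score_ceiling_bounded t : 0 <= t <= 1 ->
  bounded_outcome g (score_ceiling dg t).
Proof.
move=> /andP[t0 t1].
(* Likewise, firm 1 is treated as type 0 up to the threshold. *)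
have m1 : measurable_fun setT
    (fun th : profile => if t < th.1 then th.1 else 0).
  by apply: measurable_fun_ifT => //; exact: measurable_fun_ltr.
have m2 : measurable_fun setT (fun th : profile => Num.max t th.2).
  exact: measurable_maxr.
have [|b1 bg1] := qsym_square_bounded _ m1.
  by move=> [x y] [/=]; rewrite !in_itv/= => /andP[x0 _] _; case: ifP.
have [|b2 bg2] := qsym_square_bounded _ m2.
  by move=> th _; rewrite le_max t0.
have q1E : q1 (score_ceiling dg t) \o fst =
    qsym dg \o (fun th : profile => if t < th.1 then th.1 else 0).
  by apply/funext => th /=; case: ifP.
have bz : square_bounded (z2 (score_ceiling dg t)).
  exact: square_bounded_lt.
split => //.
- exact: square_boundedB (square_bounded_cst 1) bz.
- by rewrite q1E.
- by rewrite -compA q1E.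
Qed.

End bounded_mechanisms.

(** The allocations differ only when [s < y <= Num.min t x]: there threshold [s] selects firm 1 of
    type [x], and [t] selects firm 2 of type [y <= x]. *)
Lemma floor_production_cost_lt g dg d2g s t : investment_cost g dg d2g ->
  0 <= s -> s < t -> t <= 1 ->
  ('E_(type_law)[production_cost (score_floor dg t)] <
   'E_(type_law)[production_cost (score_floor dg s)])%E.
Proof.
move=> g_cost s0 st t1; apply: (@production_cost_lt g _ _ s t) => //.
- by apply: (score_floor_bounded g_cost); apply/andP; split; lra.
- by apply: (score_floor_bounded g_cost); apply/andP; split; lra.
- move=> x y; rewrite /production_cost /= !gt_min.
  by case: (ltP s y); case: (ltP t y); case: (ltP x y) => /=; lra.
- move=> x y; rewrite /production_cost /= !gt_min.
  by case: (ltP s y); case: (ltP t y); case: (ltP x y) => /=; lra.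
Qed.

(** The allocations differ only when [Num.max s y < x <= t]: there threshold [s] selects firm 2 of
    type [y < x], and [t] selects firm 1 of type [x]. *)
Lemma ceiling_production_cost_lt g dg d2g s t : investment_cost g dg d2g ->
  0 <= s -> s < t -> t <= 1 ->
  ('E_(type_law)[production_cost (score_ceiling dg s)] <
   'E_(type_law)[production_cost (score_ceiling dg t)])%E.
Proof.
move=> g_cost s0 st t1; apply: (@production_cost_lt g _ _ s t) => //.
- by apply: (score_ceiling_bounded g_cost); apply/andP; split; lra.
- by apply: (score_ceiling_bounded g_cost); apply/andP; split; lra.
- move=> x y; rewrite /production_cost /= !gt_max.
  by case: (ltP s x); case: (ltP t x); case: (ltP y x) => /=; lra.
- move=> x y; rewrite /production_cost /= !gt_max.
  by case: (ltP s x); case: (ltP t x); case: (ltP y x) => /=; lra.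
Qed.

End mechanism_theory.

Theorem proposition12 (R : realType) (alpha : R) (g dg d2g : R -> R)
    (alpha_gt0 : 0 < alpha) (g_cost : investment_cost g dg d2g) :
  (forall topt teff : R,
     optimal_threshold g alpha (score_floor dg) topt ->
     efficient_threshold g alpha (score_floor dg) teff ->
     teff <= topt) /\
  (forall topt teff : R,
     optimal_threshold g alpha (score_ceiling dg) topt ->
     efficient_threshold g alpha (score_ceiling dg) teff ->
     topt <= teff).
Proof.
(* In the reverse order, strict monotonicity in the threshold would make the expected producing type
   larger at [topt], against revealed preference. *)
split=> topt teff opt eff; rewrite leNgt; apply/negP => lt_t;
  move: (opt.1) (eff.1) => /andP[opt0 opt1] /andP[eff0 eff1].
- have bounded t := score_floor_bounded g_cost t.
  have := revealed_preference _ _ _ _ _ alpha_gt0 bounded opt eff.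
  by rewrite leNgt (floor_production_cost_lt _ _ _ _ _ g_cost).
- have bounded t := score_ceiling_bounded g_cost t.
  have := revealed_preference _ _ _ _ _ alpha_gt0 bounded opt eff.
  by rewrite leNgt (ceiling_production_cost_lt _ _ _ _ _ g_cost).
Qed.
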